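(* Let $\vec{\mathcal G}=([n],E)$ be an ergodic graph of a deterministic two-player mean-payoff game with $m=|E|$, and let the weights $(r_{ij})$ be independent absolutely continuous random variables with densities $f_{ij}$ satisfying $f_{ij}(y)\le\phi$ for all $(i,j),y$, for some $\phi>0$. Let $\delta=1/(4n(2n+1)m\phi)$. Then $$\mathbb P\bigl(\exists (\sigma,\tau)\in\Xi:\ B_\infty(r,\delta)\subseteq\mathcal P^{\sigma,\tau}\bigr)\ge 1-\frac1n,$$ where $B_\infty(r,\delta)=\{\tilde r:\|r-\tilde r\|_\infty\le\delta\}$.
   Context: Setting: directed graph $\vec{\mathcal G}=([n],E)$ without multiple edges, each vertex having an outgoing edge, $[n]=V_{\max}\uplus V_{\min}$, weights $r\in\mathbb R^E$. Ergodic equation in $(\lambda,u)$: $\lambda+u_i=\max_{(i,j)\in E}\{r_{ij}+u_j\}$ ($i\in V_{\max}$), $\lambda+u_i=\min_{(i,j)\in E}\{r_{ij}+u_j\}$ ($i\in V_{\min}$); $u$ is a bias if $(\lambda,u)$ solves it; ergodic graph: solvable for every $r$. Policies $\sigma:V_{\max}\to[n]$, $\tau:V_{\min}\to[n]$ choose outgoing edges; the pair is bias-induced if some bias makes every $\sigma(i)$ attain the max and every $\tau(i)$ attain the min. $\Xi$: pairs whose induced subgraph (each vertex keeping only its chosen edge) has exactly one directed cycle. $\mathcal P^{\sigma,\tau}$: set of $r$ for which $(\sigma,\tau)$ is the only bias-induced pair. *)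

(* Defs.v *)
From HB Require Import structures.
From mathcomp Require Import all_boot all_order all_algebra.
From mathcomp Require Import all_classical all_reals all_analysis.
Set Implicit Arguments. Unset Strict Implicit. Unset Printing Implicit Defensive.
Import Order.TTheory GRing.Theory Num.Theory.
Local Open Scope ring_scope.
Local Open Scope classical_set_scope.

Notation edge n E := {e : 'I_n * 'I_n | E e.1 e.2}.

Section Game.
Context {R : realType} {n : nat} (E : rel 'I_n) (Vmax : {set 'I_n}).

(* weight r_ij of (i,j) (only meaningful when (i,j) is an edge) *)
Definition wt (r : edge n E -> R) (i j : 'I_n) : R :=
  if @insub _ (fun e : 'I_n * 'I_n => E e.1 e.2) (edge n E) (i, j) is Some e
  then r e else 0.

(* (lambda,u) solves the ergodic equation; max / min over the outgoing
   edges written out as "upper (lower) bound which is attained". *)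
Definition solves_ergodic (r : edge n E -> R) (lam : R) (u : 'I_n -> R) : Prop :=
  forall i : 'I_n,
    if i \in Vmax then
      (forall j, E i j -> wt r i j + u j <= lam + u i) /\
      (exists j, E i j /\ wt r i j + u j = lam + u i)
    else
      (forall j, E i j -> lam + u i <= wt r i j + u j) /\
      (exists j, E i j /\ wt r i j + u j = lam + u i).

Definition is_bias (r : edge n E -> R) (u : 'I_n -> R) : Prop :=
  exists lam, solves_ergodic r lam u.

Definition ergodic_graph : Prop :=
  forall r : edge n E -> R, exists lam u, solves_ergodic r lam u.

Definition max_policy := {i : 'I_n | i \in Vmax} -> 'I_n.
Definition min_policy := {i : 'I_n | i \in ~: Vmax} -> 'I_n.

Definition valid_policies (sigma : max_policy) (tau : min_policy) : Prop :=
  (forall i, E (val i) (sigma i)) /\ (forall i, E (val i) (tau i)).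

Definition bias_induced (r : edge n E -> R) (sigma : max_policy)
    (tau : min_policy) : Prop :=
  exists lam u, solves_ergodic r lam u /\
    (forall i, wt r (val i) (sigma i) + u (sigma i) = lam + u (val i)) /\
    (forall i, wt r (val i) (tau i) + u (tau i) = lam + u (val i)).

Definition induced_succ (sigma : max_policy) (tau : min_policy) (i : 'I_n)
    : 'I_n :=
  match @insub _ (fun k : 'I_n => k \in Vmax) {k : 'I_n | k \in Vmax} i with
  | Some k => sigma k
  | None =>
    match @insub _ (fun k : 'I_n => k \in ~: Vmax)
                 {k : 'I_n | k \in ~: Vmax} i with
    | Some k => tau k
    | None => i
    end
  end.

(* C is (the vertex set of) a directed cycle of the induced subgraph: it is
   traversed by a nonempty duplicate-free sequence c with
   c_0 -> c_1 -> ... -> c_last -> c_0 along induced edges. In the induced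
   (functional) subgraph a directed cycle is determined by its vertex set. *)
Definition induced_cycle (sigma : max_policy) (tau : min_policy)
    (C : {set 'I_n}) : Prop :=
  exists c : seq 'I_n, [/\ c != [::], uniq c,
    cycle (fun x y => y == induced_succ sigma tau x) c & C = [set x in c]].

Definition in_Xi (sigma : max_policy) (tau : min_policy) : Prop :=
  valid_policies sigma tau /\
  exists C, induced_cycle sigma tau C /\
    forall C', induced_cycle sigma tau C' -> C' = C.

Definition Pcell (sigma : max_policy) (tau : min_policy)
    : set (edge n E -> R) :=
  [set r | bias_induced r sigma tau /\
     forall sigma' tau', valid_policies sigma' tau' ->
       bias_induced r sigma' tau' ->
       (forall i, sigma' i = sigma i) /\ (forall i, tau' i = tau i)].

Definition ball_inf (r : edge n E -> R) (delta : R) : set (edge n E -> R) :=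
  [set r' | forall e, `|r e - r' e| <= delta].

End Game.

Definition mutually_independent {R : realType} {d : measure_display}
    {Omega : measurableType d} (P : probability Omega R) {I : finType}
    (X : I -> Omega -> R) : Prop :=
  forall (S : {set I}) (A : I -> set R), (forall i, measurable (A i)) ->
    P [set w | forall i, i \in S -> A i (X i w)] =
    (\prod_(i in S) P (X i @^-1` A i))%E.

(* Main.v *)
Require Import Defs.
From HB Require Import structures.
From mathcomp Require Import all_boot all_order all_algebra.
From mathcomp Require Import all_classical all_reals all_analysis.
From mathcomp Require Import measurable_realfun.
From mathcomp Require Import ring lra zify.
Set Implicit Arguments. Unset Strict Implicit. Unset Printing Implicit Defensive.
Import Order.TTheory GRing.Theory Num.Theory.
Local Open Scope ring_scope.

(** If an optimal policy pair does not use the edge [e], then making [e] even less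
    attractive for the player owning it leaves the bias unchanged. Hence for fixed
    weights off [e] there is a single threshold for the weight of [e], namely
    [lam + u i - u j] for a bias [u] of the game without [e]; it is well defined
    as soon as no two disjoint cycles have the same mean weight, an almost sure
    event. Being independent of the weight of [e], the threshold lies within
    [alpha] of it with probability at most [2 * alpha * phi].

    When every weight is at distance more than [alpha = 4 * n * delta] from its
    threshold, the optimal policies form a graph with a single cycle, and every
    unused edge has slack more than [alpha]. A perturbation of size [delta]
    changes the slacks (which are explicit linear functionals of the weights once
    the policies are fixed) by less than [alpha], so the policies stay strictly
    optimal, and strict optimality along a graph with a single cycle forces
    uniqueness. The union bound gives [m * 2 * alpha * phi = 2 / (2 * n + 1)].

    The probability of the event is only meaningful because the event is
    measurable: each cell is cut out by finitely many strict linear inequalities. *)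

(** * Functional graphs and their potentials *)

Section FunctionalGraph.
Variables (T : finType) (g : T -> T).

(** As [g c] leads back to [c] too, [c] lies on a cycle, and every other cycle would have to contain
    it: this encodes a functional graph with a single cycle and a marked vertex on it. *)
Definition rooted (c : T) : bool := [forall i, fconnect g i c].

(** After [order g x] steps the orbit of [x] falls back on an earlier iterate, which is therefore
    periodic. *)
Lemma fconnect_periodic x :
  exists2 y, fconnect g x y & fconnect g (g y) y.
Proof.
have /trajectP[k lt_k e] := looping_order g x.
exists (iter k g x); first exact: fconnect_iter.
suff {2}-> : iter k g x = iter (order g x - k).-1 g (g (iter k g x)).
  exact: fconnect_iter.
by rewrite -iterSr -iterD prednK ?subn_gt0 // subnK ?e // ltnW.
Qed.

Lemma closed_fconnect (S : {pred T}) x y :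
  (forall i, i \in S -> g i \in S) -> x \in S -> fconnect g x y -> y \in S.
Proof.
move=> gS xS /iter_findex <-.
by elim: (findex _ _ _) => //= k; apply: gS.
Qed.

(** Brings cycles into the form [h @: C = C] used by [generic]. *)
Lemma imset_cycle y : fconnect g (g y) y ->
  g @: [set z | fconnect g y z] = [set z | fconnect g y z].
Proof.
move=> gy; apply/setP=> z; rewrite inE; apply/imsetP/idP => [[x]|].
  rewrite inE => yx ->; exact: connect_trans yx (fconnect1 _ _).
move=> /iter_findex; case: (findex _ _ _) => [|k] /= <-.
  exists (iter (findex g (g y) y) g y); rewrite ?inE ?fconnect_iter //.
  by rewrite -iterS iterSr iter_findex.
by exists (iter k g y); rewrite // inE fconnect_iter.
Qed.

Lemma rooted_closed c (S : {pred T}) x : rooted c ->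
  (forall i, i \in S -> g i \in S) -> x \in S -> c \in S.
Proof. by move=> /forallP/(_ x) xc gS xS; apply: closed_fconnect xc. Qed.

End FunctionalGraph.

Section Potential.
Variables (R : realFieldType) (T : finType) (g : T -> T) (c : T).

(** Length of the cycle through [c]; the search starts at [g c] because [findex g c c] is 0. *)
Definition period := (findex g (g c) c).+1.

Definition mean (w : T -> R) : R :=
  (\sum_(k < period) w (iter k g c)) / period%:R.

(** The bias of the graph of [g] alone, normalised to vanish at [c]: the excess of the weights over
    their mean, accumulated on the way to [c]. *)
Definition pot (w : T -> R) (i : T) : R :=
  \sum_(k < findex g i c) (w (iter k g i) - mean w).

Hypothesis gc : rooted g c.

(** Away from [c] the sum loses its first term; at [c], the weights met on one turn of the cycle add
    up to [mean w * period]. *)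
Lemma pot_eq w i : mean w + pot w i = w i + pot w (g i).
Proof.
have gP x : fconnect g x c by exact: (forallP gc x).
have [->|ic] := eqVneq i c.
  rewrite {1}/pot findex0 big_ord0 addr0 /pot sumrB sumr_const card_ord.
  have pm : \sum_(k < period) w (iter k g c) = mean w * period%:R.
    by rewrite /mean mulfVK // pnatr_eq0.
  move: pm; rewrite /period big_ord_recl.
  under eq_bigr do rewrite lift0 iterSr.
  rewrite -natr1 mulrDr mulr1 mulr_natr /= => pm.
  by rewrite addrA pm; ring.
rewrite {1}/pot (fconnect_findex (gP i)) 1?eq_sym // big_ord_recl.
under eq_bigr do rewrite lift0 iterSr.
by rewrite -/(pot w (g i)) /=; ring.
Qed.

Lemma pot_root w : pot w c = 0.
Proof. by rewrite /pot findex0 big_ord0. Qed.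

(** Along every edge [u - pot w] grows by [lam - mean w]; one turn of the cycle forces this
    increment to vanish, so the difference is constant on every path to [c]. *)
Lemma pot_unique w lam u : (forall i, lam + u i = w i + u (g i)) ->
  lam = mean w /\ forall i, u i = u c + pot w i.
Proof.
move=> lamu.
pose v i := u i - pot w i; pose mu := lam - mean w.
have vE i : v (g i) = v i + mu.
  by rewrite /v /mu; have := lamu i; have := pot_eq w i; lra.
have viter k i : v (iter k g i) = v i + k%:R * mu.
  elim: k => [|k IH] /=; first by rewrite mul0r addr0.
  rewrite vE IH -natr1; ring.
have gP x : fconnect g x c by exact: (forallP gc x).
have mu0 : mu = 0.
  have := viter period c; rewrite iterSr iter_findex // => H.
  have /eqP : period%:R * mu = 0 by lra.
  by rewrite mulf_eq0 pnatr_eq0 /= => /eqP.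
split; first by move: mu0; rewrite /mu; lra.
move=> i; have := viter (findex g i c) i.
by rewrite iter_findex // mu0 mulr0 /v pot_root; lra.
Qed.

Lemma mean_bound w (d : R) : (forall i, `|w i| <= d) -> `|mean w| <= d.
Proof.
move=> wd; rewrite normrM normfV (ger0_norm (ler0n _ _)).
rewrite ler_pdivrMr ?ltr0n //; apply: le_trans (ler_norm_sum _ _ _) _.
apply: le_trans (ler_sum _ (fun i _ => wd _)) _.
by rewrite sumr_const card_ord mulr_natr.
Qed.

Lemma pot_bound w (d : R) i : (forall i, `|w i| <= d) ->
  `|pot w i| <= d *+ 2 *+ #|T|.-1.
Proof.
move=> wd; apply: le_trans (ler_norm_sum _ _ _) _.
have d0 : 0 <= d by apply: le_trans (wd i).
have H x : `|w x - mean w| <= d *+ 2.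
  apply: le_trans (ler_normB _ _) _; rewrite mulr2n lerD //.
  exact: mean_bound.
apply: le_trans (ler_sum _ (fun i _ => H _)) _.
rewrite sumr_const card_ord ler_wpMn2l ?mulrn_wge0 //.
have /findex_max/leq_trans/(_ (max_card _)) := forallP gc i.
by case: #|T| => // k; rewrite ltnS.
Qed.

End Potential.

(** * Optimal policies *)

Section Game.
Variables (R : realFieldType) (T : finType) (Vmax : {set T}).
Implicit Types (E : rel T) (w : T -> T -> R) (u v : T -> R) (g : T -> T).

(* Signed slack of the ergodic equation along (i, j): for both players,
   optimality means that it is nonnegative, and zero on the chosen edge. *)
Definition gap w (lam : R) u i j : R :=
  (if i \in Vmax then 1 else -1) * (lam + u i - w i j - u j).

Definition optimal E w lam u g :=
  [/\ forall i, E i (g i), forall i, lam + u i = w i (g i) + u (g i) &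
      forall i j, E i j -> 0 <= gap w lam u i j].

Definition strictly_optimal E w lam u g :=
  [/\ forall i, E i (g i), forall i, lam + u i = w i (g i) + u (g i) &
      forall i j, E i j -> j != g i -> 0 < gap w lam u i j].

Lemma gap_eq w lam u i j : lam + u i = w i j + u j -> gap w lam u i j = 0.
Proof. by move=> e; rewrite /gap e; ring. Qed.

Lemma gap0_eq w lam u i j : gap w lam u i j = 0 -> lam + u i = w i j + u j.
Proof. by rewrite /gap; case: ifP => _ H; lra. Qed.

Lemma strictly_optimalW E w lam u g :
  strictly_optimal E w lam u g -> optimal E w lam u g.
Proof.
move=> [Eg gE gt0]; split=> // i j Eij; have [->|ne] := eqVneq j (g i).
  by rewrite gap_eq.
exact/ltW/gt0.
Qed.

(** Mixing the policies of two solutions makes both optimality inequalities point the same way: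
    along this map the difference of the biases grows by at least [lam - lam']. *)
Definition crossing g g' i := if i \in Vmax then g i else g' i.

Lemma crossing_edge E g g' : (forall i, E i (g i)) -> (forall i, E i (g' i)) ->
  forall i, E i (crossing g g' i).
Proof. by move=> Eg Eg' i; rewrite /crossing; case: ifP. Qed.

(* Vmax plays optimally for [u] and Vmin optimally for [u']. *)
Lemma crossing_gap E w lam lam' u u' g g' i :
  optimal E w lam u g -> optimal E w lam' u' g' ->
  let h := crossing g g' i in
  lam - lam' + (u i - u' i) + `|gap w lam u i h| + `|gap w lam' u' i h|
    = u h - u' h.
Proof.
move=> [Eg gE ge] [Eg' gE' ge'] /=; rewrite /crossing.
case: ifP => iV.
  rewrite (gap_eq (gE i)) normr0 ger0_norm ?ge' // /gap iV.
  by have := gE i; lra.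
rewrite (gap_eq (gE' i)) normr0 ger0_norm ?ge // /gap iV.
by have := gE' i; lra.
Qed.

Lemma crossing_le E w lam lam' u u' g g' i :
  optimal E w lam u g -> optimal E w lam' u' g' ->
  lam - lam' + (u i - u' i) <=
  u (crossing g g' i) - u' (crossing g g' i).
Proof.
move=> o o'; have /= := crossing_gap i o o'.
set a := `|_|; set b := `|_|.
have a0 : 0 <= a by exact: normr_ge0.
by have b0 : 0 <= b by [exact: normr_ge0]; lra.
Qed.

Lemma exists_argmax (v : T -> R) (x : T) : exists i, forall j, v j <= v i.
Proof.
by exists [arg max_(i > x) v i]%O; case: arg_maxP => //= i _ H j; apply: H.
Qed.

(** At a maximiser of [u - u'] the crossing edge cannot increase the difference further. *)
Lemma optimal_value_le E w lam lam' u u' g g' (x : T) :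
  optimal E w lam u g -> optimal E w lam' u' g' -> lam <= lam'.
Proof.
move=> o o'; have [i imax] := exists_argmax (fun i => u i - u' i) x.
by have := imax (crossing g g' i); have := crossing_le i o o'; lra.
Qed.

Lemma optimal_value_unique E w lam lam' u u' g g' (x : T) :
  optimal E w lam u g -> optimal E w lam' u' g' -> lam = lam'.
Proof.
move=> o o'; apply/le_anti.
by rewrite (optimal_value_le x o o') (optimal_value_le x o' o).
Qed.

Definition argmaxs v := [set i | [forall j, v j <= v i]].

Lemma argmaxsP v i : reflect (forall j, v j <= v i) (i \in argmaxs v).
Proof. by rewrite inE; apply: forallP. Qed.

(** With equal values, the increase of [u - u'] along the crossing edge is the sum of two absolute
    slacks, so at a maximiser all of them vanish. *)
Lemma argmaxs_crossing E w lam u u' g g' i :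
  optimal E w lam u g -> optimal E w lam u' g' ->
  let h := crossing g g' i in
  i \in argmaxs (fun i => u i - u' i) ->
  [/\ h \in argmaxs (fun i => u i - u' i), gap w lam u i h = 0 &
      gap w lam u' i h = 0].
Proof.
move=> o o' h /argmaxsP imax.
have H := crossing_gap i o o'; rewrite /= -/h in H.
have H1 := imax h.
have a0 := normr_ge0 (gap w lam u i h).
have b0 := normr_ge0 (gap w lam u' i h).
split.
- by apply/argmaxsP => j; have := imax j; lra.
- by apply/eqP; rewrite -normr_eq0; apply/eqP; lra.
- by apply/eqP; rewrite -normr_eq0; apply/eqP; lra.
Qed.

(** A crossing edge out of a maximiser is tight for [u], hence by strictness it is the edge of [g].
    So the maximisers are closed under [g] and contain the root; likewise the minimisers. *)
Lemma strict_root_argmaxs E w lam u u' g g' c :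
  rooted g c -> strictly_optimal E w lam u g -> optimal E w lam u' g' ->
  c \in argmaxs (fun i => u i - u' i) /\ c \in argmaxs (fun i => u' i - u i).
Proof.
move=> gc so o'; have o := strictly_optimalW so.
have [Eg gE gt0] := so; have [Eg' _ _] := o'.
have hg h i : E i h -> gap w lam u i h = 0 -> h = g i.
  move=> Ei H0; apply/eqP; apply: contraT => ne.
  by have := gt0 _ _ Ei ne; rewrite H0 ltxx.
split.
  have [i /argmaxsP imax] := exists_argmax (fun i => u i - u' i) c.
  apply: (rooted_closed gc _ imax) => j /(argmaxs_crossing o o') [jm g0 _].
  by rewrite -(hg (crossing g g' j)) //; apply: crossing_edge.
have [i /argmaxsP imax] := exists_argmax (fun i => u' i - u i) c.
apply: (rooted_closed gc _ imax) => j /(argmaxs_crossing o' o) [jm _ g0].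
by rewrite -(hg (crossing g' g j)) //; apply: crossing_edge.
Qed.

(** [u - u'] is both maximal and minimal at the root, hence constant, so the edges of [g'] are tight
    for [u] as well. *)
Lemma strict_unique E w lam lam' u u' g g' c :
  rooted g c -> strictly_optimal E w lam u g -> optimal E w lam' u' g' ->
  g' =1 g.
Proof.
move=> gc so o'; have o := strictly_optimalW so.
have ll := optimal_value_unique c o o'; rewrite -{lam'}ll in o'.
have [/argmaxsP m1 /argmaxsP m2] := strict_root_argmaxs gc so o'.
have [Eg gE gt0] := so; have [Eg' gE' _] := o'.
move=> i; apply/eqP; apply: contraT => ne; have := gt0 _ _ (Eg' i) ne.
rewrite gap_eq ?ltxx //.
have := m1 i; have := m2 i; have := m1 (g' i); have := m2 (g' i).
by have := gE' i; lra.
Qed.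

(* [h @: C = C] makes [C] a union of cycles of [h], so that no separate notion of
   cycle is needed: distinct means are required for any two disjoint such sets. *)
Definition generic E w := forall (h : {ffun T -> T}) (C D : {set T}),
  (0 < #|C|)%N -> (0 < #|D|)%N -> [disjoint C & D] -> h @: C = C -> h @: D = D ->
  (forall i, i \in C :|: D -> E i (h i)) ->
  (\sum_(i in C) w i (h i)) *+ #|D| != (\sum_(i in D) w i (h i)) *+ #|C|.

Lemma sub_generic E E' w : subrel E' E -> generic E w -> generic E' w.
Proof.
by move=> EE gen h C D C0 D0 CD hC hD Eh; apply: gen => // i /Eh; apply: EE.
Qed.

(** [h] permutes [C], so the biases cancel when the equations are summed. *)
Lemma cycle_mean w lam u (h : T -> T) (C : {set T}) : h @: C = C ->
  (forall i, i \in C -> lam + u i = w i (h i) + u (h i)) ->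
  \sum_(i in C) w i (h i) = lam *+ #|C|.
Proof.
move=> hC e; have hinj : {in C &, injective h}.
  by apply/imset_injP; rewrite hC.
have : \sum_(i in C) u (h i) = \sum_(i in C) u i.
  by rewrite -[in RHS]hC big_imset.
have : \sum_(i in C) (lam + u i) = \sum_(i in C) (w i (h i) + u (h i)).
  exact: eq_bigr.
by rewrite !big_split /= sumr_const => e1 e2; lra.
Qed.

(* Otherwise S and S' would contain disjoint cycles, both of mean [lam]. *)
Lemma generic_meet E w lam u u' (h h' : T -> T) (S S' : {set T}) x x' :
  generic E w -> x \in S -> x' \in S' ->
  (forall i, i \in S -> [/\ E i (h i), h i \in S &
     lam + u i = w i (h i) + u (h i)]) ->
  (forall i, i \in S' -> [/\ E i (h' i), h' i \in S' &
     lam + u' i = w i (h' i) + u' (h' i)]) ->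
  ~~ [disjoint S & S'].
Proof.
move=> gen xS xS' hS hS'; apply/negP => dis.
have [y xy yy] := fconnect_periodic h x.
have [y' xy' yy'] := fconnect_periodic h' x'.
pose C := [set z | fconnect h y z]; pose C' := [set z | fconnect h' y' z].
have CS : C \subset S.
  apply/fintype.subsetP => z; rewrite inE => yz.
  by apply: closed_fconnect (connect_trans xy yz) => // i /hS[].
have CS' : C' \subset S'.
  apply/fintype.subsetP => z; rewrite inE => yz.
  by apply: closed_fconnect (connect_trans xy' yz) => // i /hS'[].
(* Genericity speaks of one map for both cycles, so [h] and [h'] are glued. *)
pose k := [ffun i => if i \in S then h i else h' i].
have kC : {in C, k =1 h} by move=> i /(fintype.subsetP CS) iS; rewrite ffunE iS.
have kC' : {in C', k =1 h'}.
  move=> i /(fintype.subsetP CS') iS; rewrite ffunE ifF //.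
  by apply: contraTF dis => iS1; apply/pred0Pn; exists i; rewrite /= iS1.
have hC := imset_cycle yy; have hC' := imset_cycle yy'.
have kCC : k @: C = C by rewrite (eq_in_imset kC).
have kCC' : k @: C' = C' by rewrite (eq_in_imset kC').
apply: (negP (gen k C C' _ _ _ kCC kCC' _)).
- by apply/card_gt0P; exists y; rewrite inE.
- by apply/card_gt0P; exists y'; rewrite inE.
- exact: disjointWl CS (disjointWr CS' dis).
- move=> i /setUP[iC|iC].
    by rewrite kC //; case: (hS i (fintype.subsetP CS _ iC)).
  by rewrite kC' //; case: (hS' i (fintype.subsetP CS' _ iC)).
have -> : \sum_(i in C) w i (k i) = lam *+ #|C|.
  apply: (@cycle_mean w lam u) => // i iC.
  by rewrite kC //; case: (hS i (fintype.subsetP CS _ iC)).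
have -> : \sum_(i in C') w i (k i) = lam *+ #|C'|.
  apply: (@cycle_mean w lam u') => // i iC.
  by rewrite kC' //; case: (hS' i (fintype.subsetP CS' _ iC)).
by rewrite mulrnAC.
Qed.

(** The maximisers and the minimisers of [u - u'] are each closed under a tight crossing map, so by
    [generic_meet] they share a point and the difference is constant. *)
Lemma generic_unique E w lam lam' u u' g g' i j : generic E w ->
  optimal E w lam u g -> optimal E w lam' u' g' ->
  lam = lam' /\ u i - u' i = u j - u' j.
Proof.
move=> gen o o'.
have ll := optimal_value_unique i o o'; rewrite -{lam'}ll in o' *; split=> //.
have [x xmax] := exists_argmax (fun i => u i - u' i) i.
have [y ymax] := exists_argmax (fun i => u' i - u i) i.
have /pred0Pn[z /= /andP[/argmaxsP zm /argmaxsP zm']] : ~~ [disjoint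
    argmaxs (fun i => u i - u' i) & argmaxs (fun i => u' i - u i)].
  have [Eg _ _] := o; have [Eg' _ _] := o'.
  apply: (@generic_meet E w lam u u' (crossing g g') (crossing g' g) _ _ x y) => //.
  - by apply/argmaxsP.
  - by apply/argmaxsP.
  - move=> k /(argmaxs_crossing o o')[? ? _]; split=> //.
      exact: crossing_edge.
    exact: gap0_eq.
  - move=> k /(argmaxs_crossing o' o)[? ? _]; split=> //.
      exact: crossing_edge.
    exact: gap0_eq.
by have := zm i; have := zm j; have := zm' i; have := zm' j; lra.
Qed.

(** The cycle found from [x] and the orbit of any [i] consist of tight edges, hence meet; from the
    common point the walk returns to [c]. *)
Lemma generic_rooted E w lam u g (x : T) : generic E w -> optimal E w lam u g ->
  exists c, rooted g c.
Proof.
move=> gen [Eg gE _]; have [c xc cc] := fconnect_periodic g x.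
exists c; apply/forallP => i.
have : ~~ [disjoint [set z | fconnect g c z] & [set z | fconnect g i z]].
  apply: (@generic_meet E w lam u u g g _ _ c i) => //; rewrite ?inE //.
  - by move=> k; rewrite !inE => ck; split=> //; apply: connect_trans ck (fconnect1 _ _).
  - by move=> k; rewrite !inE => ck; split=> //; apply: connect_trans ck (fconnect1 _ _).
case/pred0Pn=> z; rewrite /= !inE => /andP[cz iz].
apply: connect_trans iz _.
suff : z \in [set t | fconnect g t c] by rewrite inE.
apply: closed_fconnect cz => [k|]; rewrite !inE //.
move=> /iter_findex; case: (findex _ _ _) => [/= ->//|m].
by rewrite iterSr => <-; exact: fconnect_iter.
Qed.

End Game.

(** * Slacks of a fixed policy pair and edge thresholds *)

Section PolicyGap.
Variables (R : realFieldType) (T : finType) (Vmax : {set T}).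
Implicit Types (E : rel T) (w : T -> T -> R) (u : T -> R).

(** Value, bias and slacks computed from the graph of [g] alone: they are linear in [w], whether or
    not [g] is optimal. *)
Definition policy_mean w (g : T -> T) c := mean g c (fun k => w k (g k)).
Definition policy_pot w (g : T -> T) c := pot g c (fun k => w k (g k)).
Definition policy_gap w g c := gap Vmax w (policy_mean w g c) (policy_pot w g c).

Lemma policy_eq w (g : T -> T) c i : rooted g c ->
  policy_mean w g c + policy_pot w g c i = w i (g i) + policy_pot w g c (g i).
Proof. by move=> gc; apply: pot_eq. Qed.

Lemma policy_unique E w lam u g c : rooted g c -> optimal Vmax E w lam u g ->
  lam = policy_mean w g c /\ forall i, u i = u c + policy_pot w g c i.
Proof. by move=> gc [_ gE _]; apply: pot_unique. Qed.

(** The bias is fixed up to an additive constant, which cancels in the slack. *)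
Lemma policy_gapE E w lam u g c i j : rooted g c -> optimal Vmax E w lam u g ->
  policy_gap w g c i j = gap Vmax w lam u i j.
Proof.
move=> gc /(policy_unique gc)[-> uE].
by rewrite /policy_gap /gap (uE i) (uE j); congr (_ * _); ring.
Qed.

Lemma policy_meanB w w' (g : T -> T) c :
  policy_mean (fun i j => w i j - w' i j) g c =
  policy_mean w g c - policy_mean w' g c.
Proof. by rewrite /policy_mean /mean sumrB mulrBl. Qed.

Lemma policy_potB w w' (g : T -> T) c i :
  policy_pot (fun i j => w i j - w' i j) g c i =
  policy_pot w g c i - policy_pot w' g c i.
Proof.
rewrite /policy_pot /pot -sumrB; apply: eq_bigr => k _.
have := policy_meanB w w' g c; rewrite /policy_mean => ->; ring.
Qed.

Lemma policy_gapB w w' g c i j :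
  policy_gap (fun i j => w i j - w' i j) g c i j =
  policy_gap w g c i j - policy_gap w' g c i j.
Proof. by rewrite /policy_gap policy_meanB /gap !policy_potB; ring. Qed.

(** Mean and weight contribute at most [d] each, the two potentials [2 * (#|T| - 1) * d] each, in
    all [(4 * #|T| - 2) * d]: the source of the factor [4 * n] in [alpha]. *)
Lemma policy_gap_bound w g c i j (d : R) : 0 < d -> rooted g c ->
  (forall i j, `|w i j| <= d) -> `|policy_gap w g c i j| < d *+ (4 * #|T|).
Proof.
move=> d0 gc wd; rewrite /policy_gap /gap normrM.
have -> : `|if i \in Vmax then 1 else -1 : R| = 1.
  by case: ifP; rewrite ?normrN normr1.
rewrite mul1r.
have m := mean_bound g c (fun k => wd k (g k)).
have p x := pot_bound gc x (fun k => wd k (g k)).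
move: (p i) (p j) (wd i j) m; rewrite -/(policy_mean w g c).
rewrite -/(policy_pot w g c i) -/(policy_pot w g c j).
have : (0 < #|T|)%N by apply/card_gt0P; exists c.
case: #|T| => // n _; rewrite /= mulnS mulrnDr -!mulrnA.
have -> : d *+ (4 * n) = d *+ (2 * n) + d *+ (2 * n) by rewrite -mulrnDr; congr (_ *+ _); lia.
set D := d *+ (2 * n); rewrite !ler_norml => /andP[? ?] /andP[? ?] /andP[? ?] /andP[? ?].
have -> : d *+ 4 = 4 * d by rewrite mulr_natl.
rewrite ltr_norml; apply/andP; split; lra.
Qed.

Lemma policy_strictly_optimal E w (g : T -> T) c : (forall i, E i (g i)) -> rooted g c ->
  (forall i j, E i j -> j != g i -> 0 < policy_gap w g c i j) ->
  strictly_optimal Vmax E w (policy_mean w g c) (policy_pot w g c) g.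
Proof. by move=> Eg gc H; split=> // i; apply: policy_eq. Qed.

Definition del_edge E (a b : T) : rel T := [rel i j | E i j && ((i, j) != (a, b))].

(** Optimality with a single cycle, as a boolean on a finite type, so that [threshold] can scan all
    pairs and stay measurable. *)
Definition candidate E w (p : {ffun T -> T} * T) :=
  [&& [forall i, E i (p.1 i)], rooted p.1 p.2 &
      [forall i, [forall j, E i j ==> (0 <= policy_gap w p.1 p.2 i j)]]].

Lemma candidate_optimal E w p : candidate E w p ->
  optimal Vmax E w (policy_mean w p.1 p.2) (policy_pot w p.1 p.2) p.1.
Proof.
case/and3P => /forallP Eg gc /forallP ge; split=> // [i|i j Eij].
  exact: policy_eq.
by have /forallP/(_ j)/implyP/(_ Eij) := ge i.
Qed.

(* The weight of (a, b) beyond which this edge becomes profitable for the player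
   owning [a]. It only depends on the other weights; the junk value 0 is returned
   when the game without (a, b) has no optimal policies with a single cycle. *)
Definition threshold E (a b : T) w : R :=
  foldr (fun p acc => if candidate (del_edge E a b) w p
     then policy_mean w p.1 p.2 + policy_pot w p.1 p.2 a - policy_pot w p.1 p.2 b
     else acc) 0 (enum {: {ffun T -> T} * T}).

(** By [generic_rooted] some candidate exists, and by [generic_unique] all candidates give the same
    number, so the order of the scan is immaterial. *)
Lemma thresholdE E a b w lam u g : generic E w ->
  optimal Vmax (del_edge E a b) w lam u g ->
  threshold E a b w = lam + u a - u b.
Proof.
move=> genE o.
have gen : generic (del_edge E a b) w.
  by apply: sub_generic genE => i j /andP[].
pose g' := [ffun i => g i].
have {}o : optimal Vmax (del_edge E a b) w lam u g'.
  by have [Eg gE ge] := o; split=> // i; rewrite ffunE.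
have [c gc] := generic_rooted a gen o.
have cand : candidate (del_edge E a b) w (g', c).
  have [/forallP Eg _ ge] := o; apply/and3P; split=> //.
  apply/forallP => i; apply/forallP => j; apply/implyP => Eij.
  by rewrite (policy_gapE i j gc o) ge.
have H p : candidate (del_edge E a b) w p ->
    policy_mean w p.1 p.2 + policy_pot w p.1 p.2 a - policy_pot w p.1 p.2 b
    = lam + u a - u b.
  by move=> /candidate_optimal /(generic_unique a b gen o)[]; lra.
rewrite /threshold; have : (g', c) \in enum {: {ffun T -> T} * T}.
  by rewrite mem_enum.
elim: (enum _) => //= p s IH; rewrite inE => /orP[/eqP <-|/IH ->].
  by rewrite cand; apply: H.
by case: ifP => // /H.
Qed.

(** As [g] avoids the edge, it stays optimal with the same bias once the edge is deleted; the slack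
    is then exactly the distance from the weight to the threshold. *)
Lemma gap_gt_of_threshold E w lam u g (alpha : R) i j :
  generic E w -> optimal Vmax E w lam u g -> E i j -> j != g i ->
  alpha < `|w i j - threshold E i j w| -> alpha < gap Vmax w lam u i j.
Proof.
move=> gen o Eij ne; have [Eg gE ge] := o.
rewrite (@thresholdE E i j w lam u g gen) => [H|].
  rewrite -(ger0_norm (ge _ _ Eij)) /gap normrM.
  have -> : `|if i \in Vmax then 1 else -1 : R| = 1.
    by case: ifP; rewrite ?normrN normr1.
  rewrite mul1r -normrN.
  by have -> : - (lam + u i - w i j - u j) = w i j - (lam + u i - u j) by ring.
split=> // [k|k l /andP[Ekl _]]; last exact: ge.
rewrite /del_edge /= Eg /=; apply: contra ne => /eqP[-> <-]; exact: eqxx.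
Qed.

End PolicyGap.

(** * Independence and anti-concentration *)

Local Open Scope classical_set_scope.

Section Independence.
Context {R : realType} {d : measure_display} {Omega : measurableType d}
  (P : probability Omega R) {I : finType} (X : I -> Omega -> R).
Hypothesis mX : forall i, measurable_fun setT (X i).
Hypothesis indX : mutually_independent P X.
Variable e : I.

(** Cylinders on all coordinates but [e]: a pi-system generating the sigma-algebra of the other
    weights. *)
Definition other_boxes : set (set Omega) :=
  [set B | exists2 A : I -> set R, (forall i, measurable (A i)) &
    B = [set w | forall i, i != e -> A i (X i w)]].

Lemma other_boxes_setI : setI_closed other_boxes.
Proof.
move=> _ _ [A mA ->] [B mB ->]; exists (fun i => A i `&` B i) => [i|].
  exact: measurableI.
apply/seteqP; split=> w /=; first by move=> [a b] i ie; split; [exact: a|exact: b].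
by move=> ab; split=> i ie; case: (ab i ie).
Qed.

Lemma other_boxesT : other_boxes setT.
Proof. by exists (fun=> setT) => //; apply/seteqP; split. Qed.

Lemma forall_measurable (d' : measure_display) (T : measurableType d') (J : finType)
    (F : J -> set T) : (forall j, measurable (F j)) ->
  measurable [set w | forall j, F j w].
Proof.
move=> mF; rewrite [X in measurable X](_ : _ = \bigcap_(j in setT) F j).
  by apply: fin_bigcap_measurable => //; exact: finite_finset.
by apply/seteqP; split=> w /= H j //; apply: H.
Qed.

Lemma other_boxes_measurable : other_boxes `<=` measurable.
Proof.
move=> _ [A mA ->]; apply: forall_measurable => i.
case: (eqVneq i e) => _.
  by rewrite [X in measurable X](_ : _ = setT) //; apply/seteqP; split.
rewrite [X in measurable X](_ : _ = X i @^-1` A i).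
  by rewrite -[X in measurable X]setTI; apply: mX.
by apply/seteqP; split=> w /=; [exact|move=> ? _].
Qed.

Lemma other_boxes_indep (B : set Omega) (A : set R) : other_boxes B -> measurable A ->
  P (B `&` X e @^-1` A) = (P (X e @^-1` A) * P B)%E.
Proof.
move=> [C mC ->] mA.
(* The condition on [X e] becomes one more side of the box. *)
pose A' i := if i == e then A else C i.
have mA' i : measurable (A' i) by rewrite /A'; case: ifP.
have -> : [set w | forall i, i != e -> C i (X i w)] `&` X e @^-1` A =
    [set w | forall i, i \in [set: I]%SET -> A' i (X i w)].
  apply/seteqP; split=> w /=.
    by move=> [c a] i _; rewrite /A'; case: eqVneq => [->//|/c].
  move=> H; split=> [i ie|]; last by have := H e; rewrite inE /A' eqxx; apply.
  by have := H i; rewrite inE /A' (negbTE ie); apply.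
rewrite indX // (bigD1 e) ?inE //= {1}/A' eqxx; congr (_ * _)%E.
have -> : [set w | forall i, i != e -> C i (X i w)] =
    [set w | forall i, i \in [set~ e]%SET -> A' i (X i w)].
  apply/seteqP; split=> w /= H i.
    by rewrite !inE /A' => ie; rewrite (negbTE ie); apply: H.
  by move=> ie; have := H i; rewrite !inE /A' (negbTE ie); apply.
rewrite indX //; apply: eq_bigl => i; by rewrite !inE.
Qed.

(** Both sides are finite measures in [B] that agree on the pi-system of boxes. *)
Lemma sigma_others_indep (B : set Omega) (A : set R) :
  <<s other_boxes >> B -> measurable A ->
  P (B `&` X e @^-1` A) = (P (X e @^-1` A) * P B)%E.
Proof.
move=> sB mA.
have mXA : measurable (X e @^-1` A) by rewrite -[X in measurable X]setTI; apply: mX.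
pose m1 := mrestr P mXA.
have p0 : 0 <= fine (P (X e @^-1` A)) by rewrite fine_ge0.
pose m2 := mscale (NngNum p0) P.
have m2E C : m2 C = (P (X e @^-1` A) * P C)%E.
  by rewrite /m2 /mscale /= fineK // fin_num_measure.
rewrite -m2E -[LHS]/(m1 B).
apply: (@g_sigma_algebra_measure_unique _ _ _ other_boxes _ (fun=> setT)) => //.
- exact: other_boxes_measurable.
- by move=> _; exact: other_boxesT.
- by rewrite bigcup_const.
- exact: other_boxes_setI.
- by move=> C bC; rewrite [RHS]m2E -other_boxes_indep.
- move=> _; rewrite /= /mrestr setTI.
  by rewrite (le_lt_trans (probability_le1 _ _)) ?ltry.
Qed.

End Independence.

(** * Anti-concentration around an independent random point *)

Section AntiConcentration.
Context {R : realType} {d : measure_display} {Omega : measurableType d}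
  (P : probability Omega R) (X T : Omega -> R).
Hypothesis mX : measurable_fun setT X.
Hypothesis mT : measurable_fun setT T.
Hypothesis indXT : forall A B : set R, measurable A -> measurable B ->
  P (T @^-1` B `&` X @^-1` A) = (P (X @^-1` A) * P (T @^-1` B))%E.
Variables (f : R -> R) (phi : R).
Hypothesis mf : measurable_fun setT f.
Hypothesis f_ge0 : forall y, 0 <= f y.
Hypothesis densX : forall A : set R, measurable A ->
  P (X @^-1` A) = (\int[lebesgue_measure]_(y in A) (f y)%:E)%E.
Hypothesis f_le : forall y, f y <= phi.

Lemma density_itv_le (a b : R) : a <= b ->
  (P (X @^-1` `[a, b]) <= (phi * (b - a))%:E)%E.
Proof.
move=> ab; rewrite densX //.
have p0 : 0 <= phi by exact: le_trans (f_ge0 0) (f_le 0).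
apply: (@le_trans _ _ (\int[lebesgue_measure]_(y in `[a, b]) (cst phi%:E y))%E).
  apply: ge0_le_integral => //.
  - by move=> x _; rewrite lee_fin.
  - by apply/measurable_EFinP; exact: measurable_funS mf.
  - by move=> x _; rewrite lee_fin.
rewrite integral_cst //= lebesgue_measure_itv /= lte_fin.
case: ifP => [_|/negbT]; first by rewrite -EFinB -EFinM.
by rewrite -leNgt => ba; rewrite mule0 lee_fin mulr_ge0 // subr_ge0.
Qed.

Lemma measurable_strip (alpha : R) :
  measurable [set z : R * R | `|z.2 - z.1| <= alpha].
Proof.
have m : measurable_fun setT (fun z : R * R => `|z.2 - z.1|).
  apply: measurableT_comp => //; apply: measurable_funB;
    [exact: measurable_snd|exact: measurable_fst].
rewrite -[X in measurable X]setTI; exact: (measurable_fun_le _ m).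
Qed.

(** Independence makes the law of [(T, X)] a product, so the probability of the strip is the average
    over [t] of the mass of an interval of length [2 * alpha]. *)
Lemma anti_concentration (alpha : R) : 0 <= alpha ->
  (P [set w | (`|X w - T w| <= alpha)%R] <= (2 * alpha * phi)%:E)%E.
Proof.
move=> a0; pose S := [set z : R * R | `|z.2 - z.1| <= alpha].
have mS : measurable S := measurable_strip alpha.
have mTX : measurable_fun setT (fun w => (T w, X w)).
  exact: measurable_fun_pair.
pose T' : {mfun Omega >-> R} := mfun_Sub (mem_set mT).
pose X' : {mfun Omega >-> R} := mfun_Sub (mem_set mX).
pose TX' : {mfun Omega >-> (R * R)%type} := mfun_Sub (mem_set mTX).
have -> : [set w | `|X w - T w| <= alpha] = TX' @^-1` S by [].
rewrite -[P (_ @^-1` _)]/(distribution P TX' S).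
rewrite -(@product_measure_unique _ _ _ _ _ (distribution P T') (distribution P X')) //;
  last first.
  move=> A B mA mB; rewrite muleC -[RHS]indXT //.
rewrite /product_measure1.
have H t : (distribution P X' (xsection S t) <= (2 * alpha * phi)%:E)%E.
  have -> : xsection S t = `[t - alpha, t + alpha].
    apply/seteqP; split=> x; rewrite /xsection /= inE /S /= in_itv /= ler_norml.
      by move=> /andP[? ?]; apply/andP; split; lra.
    by move=> /andP[? ?]; apply/andP; split; lra.
  apply: le_trans (density_itv_le _) _; first by lra.
  by rewrite lee_fin; lra.
have <- : (\int[distribution P T']_x cst (2 * alpha * phi)%:E x)%E =
    (2 * alpha * phi)%:E.
  apply: etrans (integral_cst _ measurableT _) _.
  by apply: etrans (mule1 _); congr (_ * _)%E; exact: probability_setT.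
apply: ge0_le_integral => //.
- exact: measurable_fun_xsection.
- by move=> x _; exact: H.
Qed.

End AntiConcentration.

(** * Linear functionals of the weights *)

Section LinearOn.
Context {R : realType} {I : finType}.
Implicit Types (D : pred I) (L : (I -> R) -> R).

(** The support condition records which weights [L] may depend on, hence for which sigma-algebra it
    is measurable. *)
Definition linear_on D L := exists a : I -> R,
  (forall i, ~~ D i -> a i = 0) /\ forall x, L x = \sum_i a i * x i.

Lemma linear_on_coord D i : D i -> linear_on D (fun x => x i).
Proof.
move=> Di; exists (fun j => (j == i)%:R); split.
  by move=> j; case: eqVneq => // ->; rewrite Di.
move=> x; rewrite (bigD1 i) //= eqxx mul1r big1 ?addr0 // => j /negbTE ->.
by rewrite mul0r.
Qed.

Lemma linear_on0 D : linear_on D (fun=> 0).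
Proof.
by exists (fun=> 0); split=> // x; rewrite big1 // => i _; rewrite mul0r.
Qed.

Lemma linear_onD D L L' : linear_on D L -> linear_on D L' ->
  linear_on D (fun x => L x + L' x).
Proof.
move=> [a [a0 La]] [b [b0 Lb]]; exists (fun i => a i + b i); split.
  by move=> i Di; rewrite a0 // b0 // addr0.
by move=> x; rewrite La Lb -big_split; apply: eq_bigr => i _; rewrite mulrDl.
Qed.

Lemma linear_onM D L k : linear_on D L -> linear_on D (fun x => k * L x).
Proof.
move=> [a [a0 La]]; exists (fun i => k * a i); split.
  by move=> i Di; rewrite a0 // mulr0.
by move=> x; rewrite La mulr_sumr; apply: eq_bigr => i _; rewrite mulrA.
Qed.

Lemma linear_on_ext D L L' : L =1 L' -> linear_on D L -> linear_on D L'.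
Proof.
by move=> e [a [a0 La]]; exists a; split=> // x; rewrite -e.
Qed.

Lemma linear_onB D L L' : linear_on D L -> linear_on D L' ->
  linear_on D (fun x => L x - L' x).
Proof.
move=> lL /(linear_onM (-1)) /(linear_onD lL); apply: linear_on_ext => x.
by rewrite mulN1r.
Qed.

Lemma linear_onMn D L k : linear_on D L -> linear_on D (fun x => L x *+ k).
Proof.
move=> /(linear_onM k%:R); apply: linear_on_ext => x; exact: mulr_natl.
Qed.

Lemma linear_on_sum D (J : Type) (s : seq J) (Q : pred J) (F : J -> (I -> R) -> R) :
  (forall j, Q j -> linear_on D (F j)) ->
  linear_on D (fun x => \sum_(j <- s | Q j) F j x).
Proof.
move=> lF; elim: s => [|j s IH].
  by apply: linear_on_ext (linear_on0 D) => x; rewrite big_nil.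
case: (boolP (Q j)) => Qj.
  by apply: linear_on_ext (linear_onD (lF j Qj) IH) => x; rewrite big_cons Qj.
by apply: linear_on_ext IH => x; rewrite big_cons (negbTE Qj).
Qed.


Lemma linear_on_measurable (d : measure_display) (Omega : measurableType d)
    D L (X : I -> Omega -> R) : linear_on D L ->
  (forall i, D i -> measurable_fun setT (X i)) ->
  measurable_fun setT (fun w => L (X ^~ w)).
Proof.
move=> [a [a0 La]] mX.
rewrite (_ : (fun w => _) = fun w => \sum_i a i * X i w); last exact/funext.
apply: measurable_sum => i; case: (boolP (D i)) => [/mX mXi|/a0 ->].
  by apply: measurable_funM => //; exact: measurable_cst.
by under eq_fun do rewrite mul0r; exact: measurable_cst.
Qed.

(** The minimum of [L] over the ball is [L x] minus [delta] times the l1 norm of the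
    coefficients. *)
Lemma linear_on_ball_pos D L (delta : R) : 0 <= delta -> linear_on D L ->
  exists M, forall x, (forall y, (forall i, `|x i - y i| <= delta) -> 0 < L y) <-> M < L x.
Proof.
move=> d0 [a [_ La]]; exists (delta * \sum_i `|a i|) => x; split.
  (* A point of the ball where [L] is minimal. *)
  move=> H; pose y i := x i - Num.sg (a i) * delta.
  have := H y; rewrite !La => /(_ _).
  have -> : \sum_i a i * y i = \sum_i a i * x i - delta * \sum_i `|a i|.
    rewrite mulr_sumr -sumrB; apply: eq_bigr => i _.
    by rewrite /y mulrBr mulrA -[a i * Num.sg _]mulrC -normrEsg [delta * _]mulrC.
  rewrite subr_gt0; apply=> i.
  rewrite /y opprB addrCA subrr addr0 normrM (ger0_norm d0) normr_sg.
  by case: (a i != 0); rewrite ?mul1r ?mul0r.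
move=> H y xy; apply: lt_le_trans (_ : L x - delta * \sum_i `|a i| <= _).
  by rewrite subr_gt0.
rewrite !La mulr_sumr -sumrB; apply: ler_sum => i _.
have : `|a i * (x i - y i)| <= delta * `|a i|.
  by rewrite normrM mulrC ler_wpM2r.
by rewrite ler_norml mulrBr => /andP[_ ?]; lra.
Qed.

End LinearOn.

(** * Policies and cells of the game *)

Section Policies.
Context {R : realType} {n : nat} (E : rel 'I_n) (Vmax : {set 'I_n}).
Local Notation edges := (edge n E).
Implicit Types (r : edges -> R) (g : 'I_n -> 'I_n).

Lemma wt_val r (e : edges) : wt r (val e).1 (val e).2 = r e.
Proof. by rewrite /wt -surjective_pairing valK. Qed.

Lemma wtB r r' i j : wt (fun e => r e - r' e) i j = wt r i j - wt r' i j.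
Proof. by rewrite /wt; case: insubP => // _; rewrite subr0. Qed.

Lemma wt_bound r (delta : R) i j : 0 <= delta -> (forall e, `|r e| <= delta) ->
  `|wt r i j| <= delta.
Proof. by move=> d0 rd; rewrite /wt; case: insubP => // _; rewrite normr0. Qed.

Lemma wt_linear (D : pred edges) i j : (forall e, val e = (i, j) -> D e) ->
  linear_on D (fun r => wt r i j).
Proof.
move=> HD; rewrite /wt; case: insubP => [e _ eij|_]; last exact: linear_on0.
exact/linear_on_coord/HD.
Qed.

Lemma policy_mean_linear (D : pred edges) g c :
  (forall k e, val e = (k, g k) -> D e) ->
  linear_on D (fun r => policy_mean (wt r) g c).
Proof.
move=> HD; rewrite /policy_mean /mean.
apply: (linear_on_ext (fun r => mulrC _ _)).
apply/linear_onM/linear_on_sum => k _; apply: wt_linear; exact: HD.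
Qed.

Lemma policy_pot_linear (D : pred edges) g c i :
  (forall k e, val e = (k, g k) -> D e) ->
  linear_on D (fun r => policy_pot (wt r) g c i).
Proof.
move=> HD; apply: linear_on_sum => k _; apply: linear_onB.
  by apply: wt_linear; apply: HD.
exact: policy_mean_linear.
Qed.

Lemma policy_gap_linear (D : pred edges) g c i j :
  (forall k e, val e = (k, g k) -> D e) -> (forall e, val e = (i, j) -> D e) ->
  linear_on D (fun r => policy_gap Vmax (wt r) g c i j).
Proof.
move=> HD Dij; apply/linear_onM/linear_onB; last exact: policy_pot_linear.
apply: linear_onB; last exact: wt_linear.
by apply: linear_onD; [exact: policy_mean_linear|exact: policy_pot_linear].
Qed.

(** Candidates of the game without [(a, b)] never use that edge, so every test of the scan is a
    finite set of linear inequalities, and every value a linear functional, in the other weights. *)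
Lemma threshold_measurable (d : measure_display) (Omega : measurableType d)
    (X : edges -> Omega -> R) a b :
  (forall e, val e != (a, b) -> measurable_fun setT (X e)) ->
  measurable_fun setT (fun w => threshold Vmax E a b (wt (X ^~ w))).
Proof.
move=> mX; rewrite /threshold; elim: (enum _) => [|p s IH] /=.
  exact: measurable_cst.
case: (boolP [forall i, del_edge E a b i (p.1 i)]) => [/forallP Eg|ng]; last first.
  by apply: eq_measurable_fun IH => w _; rewrite /candidate (negbTE ng).
have Dg k (e : edges) : val e = (k, p.1 k) -> val e != (a, b).
  by move=> ->; case/andP: (Eg k).
apply: measurable_fun_ifT => //; last first.
  pose L r := policy_mean (wt r) p.1 p.2 + policy_pot (wt r) p.1 p.2 a -
    policy_pot (wt r) p.1 p.2 b.
  apply: (@linear_on_measurable _ _ _ _ [pred e | val e != (a, b)] L) => //.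
  apply: linear_onB; last exact: policy_pot_linear.
  by apply: linear_onD; [exact: policy_mean_linear|exact: policy_pot_linear].
apply: (measurable_fun_bool true); rewrite setTI.
have [gc|gc] := boolP (rooted p.1 p.2); last first.
  by rewrite [X in measurable X](_ : _ = set0) //; apply/seteqP; split=> w //=;
    rewrite /candidate (negbTE gc) andbF.
rewrite [X in measurable X](_ : _ = [set w | forall q : 'I_n * 'I_n,
   del_edge E a b q.1 q.2 -> 0 <= policy_gap Vmax (wt (X ^~ w)) p.1 p.2 q.1 q.2]).
  apply: forall_measurable => -[i j] /=.
  have [Eij|nE] := boolP (del_edge E a b i j); last first.
    by rewrite [X in measurable X](_ : _ = setT) //; apply/seteqP; split.
  rewrite [X in measurable X](_ : _ = setT `&`
    [set w | 0 <= policy_gap Vmax (wt (X ^~ w)) p.1 p.2 i j]); last first.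
    by rewrite setTI; apply/seteqP; split=> w /=; [exact|move=> ? _].
  apply: measurable_fun_le => //.
  apply: (@linear_on_measurable _ _ _ _ [pred e | val e != (a, b)]
    (fun r => policy_gap Vmax (wt r) p.1 p.2 i j)) => //.
  apply: policy_gap_linear => // e /= ->; by case/andP: Eij.
apply/seteqP; split=> w /=.
  by case/and3P => _ _ /forallP H [i j] /= Eij; have /forallP/(_ j)/implyP := H i; apply.
move=> H; apply/and3P; split=> //; first exact/forallP.
by apply/forallP => i; apply/forallP => j; apply/implyP => Eij; apply: (H (i, j)).
Qed.

(** A policy pair amounts to one successor map on all vertices; these restrictions invert
    [induced_succ]. *)
Definition max_part g : max_policy Vmax := fun k => g (val k).
Definition min_part g : min_policy Vmax := fun k => g (val k).

Lemma induced_succ_parts g i : induced_succ (max_part g) (min_part g) i = g i.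
Proof.
rewrite /induced_succ; case: insubP => [k _ <-//|iV].
case: insubP => [k _ <-//|]; by rewrite finset.in_setC iV.
Qed.

Lemma max_part_succ sigma (tau : min_policy Vmax) :
  max_part (induced_succ sigma tau) = sigma.
Proof. by apply/funext => k; rewrite /max_part /induced_succ valK. Qed.

Lemma min_part_succ (sigma : max_policy Vmax) tau :
  min_part (induced_succ sigma tau) = tau.
Proof.
apply/funext => k; rewrite /min_part /induced_succ.
case: insubP => [k' kV _|_]; last by rewrite valK.
by have := valP k; rewrite finset.in_setC kV.
Qed.

Lemma valid_partsP g : valid_policies E (max_part g) (min_part g) <->
  forall i, E i (g i).
Proof.
split=> [[Es Et] i|H]; last by split=> i; apply: H.
have [iV|iV] := boolP (i \in Vmax); first exact: (Es (exist _ i iV)).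
have iV' : i \in ~: Vmax by rewrite finset.in_setC.
exact: (Et (exist _ i iV')).
Qed.

Lemma solves_optimal r lam u g : (forall i, E i (g i)) ->
  (forall i, lam + u i = wt r i (g i) + u (g i)) ->
  solves_ergodic Vmax r lam u -> optimal Vmax E (wt r) lam u g.
Proof.
move=> Eg gE sol; split=> // i j Eij; have := sol i; rewrite /gap.
by case: ifP => _ [/(_ j Eij)]; lra.
Qed.

Lemma optimal_solves r lam u g : optimal Vmax E (wt r) lam u g ->
  solves_ergodic Vmax r lam u.
Proof.
move=> [Eg gE ge] i; have H j Eij := ge i j Eij; move: H; rewrite /gap.
by case: ifP => _ H; (split; last by exists (g i); split=> //; rewrite gE);
  move=> j Eij; have := H j Eij; lra.
Qed.

Lemma solves_ex_optimal r lam u : solves_ergodic Vmax r lam u ->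
  exists g, optimal Vmax E (wt r) lam u g.
Proof.
move=> sol.
have /choice[g gP] : forall i, exists j, E i j /\ wt r i j + u j = lam + u i.
  by move=> i; have := sol i; case: ifP => _ [].
by exists g; apply: solves_optimal => // i; case: (gP i).
Qed.

Lemma bias_induced_partsP r g : (forall i, E i (g i)) ->
  bias_induced r (max_part g) (min_part g) <->
  exists lam u, optimal Vmax E (wt r) lam u g.
Proof.
move=> Eg; split=> [[lam [u [sol [es et]]]]|[lam [u o]]]; exists lam, u.
  apply: solves_optimal => // i.
  have [iV|iV] := boolP (i \in Vmax); first by have /= <- := es (exist _ i iV).
  have iV' : i \in ~: Vmax by rewrite finset.in_setC.
  by have /= <- := et (exist _ i iV').
split; first exact: optimal_solves o.
by have [_ gE _] := o; split=> i; rewrite gE.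
Qed.

Lemma Pcell_partsP r g c : (forall i, E i (g i)) -> rooted g c ->
  Pcell (E:=E) (max_part g) (min_part g) r <->
  forall i j, E i j -> j != g i -> 0 < policy_gap Vmax (wt r) g c i j.
Proof.
move=> Eg gc; split.
  move=> [/(bias_induced_partsP _ Eg)[lam [u o]] uniq] i j Eij ne.
  have [_ gE ge] := o.
  rewrite (policy_gapE i j gc o) lt_neqAle ge // andbT; apply/negP => /eqP e0.
  pose g' k := if k == i then j else g k.
  have Eg' k : E k (g' k) by rewrite /g'; case: eqP => [->|].
  have o' : optimal Vmax E (wt r) lam u g'.
    by split=> // k; rewrite /g'; case: eqP => [->|//]; apply: (gap0_eq (esym e0)).
  have [||es et] := uniq (max_part g') (min_part g').
  - exact/valid_partsP.
  - by apply/bias_induced_partsP => //; exists lam, u.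
  have : g' i = g i.
    have [iV|iV] := boolP (i \in Vmax); first exact: (es (exist _ i iV)).
    have iV' : i \in ~: Vmax by rewrite finset.in_setC.
    exact: (et (exist _ i iV')).
  by rewrite /g' eqxx => /eqP; apply/negP.
move=> H; have so := policy_strictly_optimal Eg gc H; split.
  apply/bias_induced_partsP => //; do 2 eexists; exact: strictly_optimalW so.
move=> sigma tau; have := max_part_succ sigma tau; have := min_part_succ sigma tau.
move: (induced_succ _ _) => g' <- <- /valid_partsP Eg'.
move=> /(bias_induced_partsP _ Eg')[lam [u o]].
have gg := strict_unique gc so o.
by split=> i; rewrite /max_part /min_part gg.
Qed.

(** A cycle is the set reachable from any of its vertices, and every vertex leads to some cycle; so
    the cycle is unique exactly when all vertices lead to one [c]. *)
Lemma in_Xi_partsP g : in_Xi E (max_part g) (min_part g) <->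
  (forall i, E i (g i)) /\ exists c, rooted g c.
Proof.
rewrite /in_Xi valid_partsP.
pose sc := induced_succ (max_part g) (min_part g).
have scE : sc = g by apply/funext => i; exact: induced_succ_parts.
have cycE (C : {set 'I_n}) c : c \in C -> induced_cycle (max_part g) (min_part g) C ->
    C = finset (fconnect g c).
  move=> cC [s [s0 us cs Cs]]; have cs' : fcycle g s.
    by rewrite (eq_cycle (e' := fun x y => y == sc x)) // => x y /=; rewrite scE eq_sym.
  apply/setP => z; rewrite Cs !inE; symmetry; apply: fconnect_cycle => //.
  by move: cC; rewrite Cs inE.
have exC c : fconnect g (g c) c ->
    induced_cycle (max_part g) (min_part g) (finset (fconnect g c)).
  move=> cc; exists (orbit g c); split.
  - by rewrite -size_eq0 size_orbit -lt0n.
  - exact: orbit_uniq.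
  - have : fcycle g (orbit g c) by rewrite -fconnect_f.
    by rewrite (eq_cycle (e' := fun x y => y == sc x)) // => x y /=; rewrite scE eq_sym.
  - by apply/setP => z; rewrite !inE fconnect_orbit.
split=> [[Eg [C [cycC uniqC]]]|[Eg [c gc]]]; split=> //.
  have [s [s0 _ _ Cs]] := cycC.
  case: s s0 Cs => // c s _ Cs; exists c; apply/forallP => i.
  have [y iy yy] := fconnect_periodic g i.
  have := uniqC _ (exC y yy).
  have cC : c \in C by rewrite Cs !inE eqxx.
  rewrite (cycE C c cC cycC) => yc.
  apply: connect_trans iy _.
  have : c \in finset (fconnect g y) by rewrite yc inE.
  by rewrite inE.
exists (finset (fconnect g c)); split.
  by apply: exC; exact: (forallP gc).
move=> C' cycC'; apply: (cycE C' c) => //.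
have [s [s0 _ _ Cs]] := cycC'.
case: s s0 Cs => // x s _ Cs; have xC : x \in C' by rewrite Cs !inE eqxx.
by rewrite (cycE C' x xC cycC') inE; apply: (forallP gc).
Qed.

End Policies.

(** * The random game *)

Section GenericLinear.
Context {R : realType} {n : nat} (E : rel 'I_n).
Local Notation edges := (edge n E).
Implicit Types (h : {ffun 'I_n -> 'I_n}) (C D : {set 'I_n}).

(** The conditions of [generic] on a finite type, so that ties can index a union bound. *)
Definition cycle_pair (q : {ffun 'I_n -> 'I_n} * {set 'I_n} * {set 'I_n}) : bool :=
  let: (h, C, D) := q in
  [&& (0 < #|C|)%N, (0 < #|D|)%N, [disjoint C & D], h @: C == C, h @: D == D &
      [forall i, (i \in C :|: D) ==> E i (h i)]].

Definition cycle_tie (q : {ffun 'I_n -> 'I_n} * {set 'I_n} * {set 'I_n}) (r : edges -> R) : Prop :=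
  let: (h, C, D) := q in
  (\sum_(i in C) wt r i (h i)) *+ #|D| = (\sum_(i in D) wt r i (h i)) *+ #|C|.

Lemma generic_of_no_tie (r : edges -> R) :
  (forall q, cycle_pair q -> ~ cycle_tie q r) -> generic E (wt r).
Proof.
move=> H h C D C0 D0 CD hC hD Eh; apply/eqP; apply: (H (h, C, D)).
rewrite /cycle_pair C0 D0 CD hC hD !eqxx /=.
by apply/forallP => i; apply/implyP; apply: Eh.
Qed.

(* A tie determines the weight of any edge of the first cycle from the others. *)
Lemma cycle_tie_hyperplane q : cycle_pair q -> exists (e : edges) L,
  linear_on [pred e' | e' != e] L /\ forall r, cycle_tie q r -> r e = L r.
Proof.
case: q => [[h C] D] /and5P[/card_gt0P[i0 i0C] D0 CD _ /andP[_ /forallP Eh]].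
have Eh0 : E i0 (h i0) by have := Eh i0; rewrite finset.in_setU i0C.
pose e : edges := exist _ (i0, h i0) Eh0; exists e.
(* The tie equation solved for the weight of [e], which occurs once in the sum over [C] and, by
   disjointness, not in the sum over [D]. *)
pose L (r : edges -> R) := #|D|%:R^-1 * ((\sum_(i in D) wt r i (h i)) *+ #|C|
  - (\sum_(i in C | i != i0) wt r i (h i)) *+ #|D|).
exists L; split.
  apply/linear_onM/linear_onB; apply/linear_onMn/linear_on_sum.
    move=> i iD; apply: wt_linear => e' e'i; apply/eqP => ee.
    have ii : i = i0 by move: e'i; rewrite ee => -[].
    by move/disjoint_setI0: CD => /setP/(_ i0); rewrite !inE i0C -ii iD.
  move=> i /andP[_ ii]; apply: wt_linear => e' e'i; apply/eqP => ee.
  by move: e'i ii; rewrite ee => -[->]; rewrite eqxx.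
move=> r; rewrite /cycle_tie (bigD1 i0) //= => tie.
rewrite /L -tie -mulrnBl addrK -[X in _ * X]mulr_natl mulKf ?pnatr_eq0 -?lt0n //.
by rewrite -(wt_val r e).
Qed.

End GenericLinear.

Section Smoothed.
Context {R : realType} {n : nat} (E : rel 'I_n) (Vmax : {set 'I_n})
  {d : measure_display} {Omega : measurableType d} (P : probability Omega R).
Local Notation edges := (edge n E).
Variables (X : edges -> Omega -> R) (f : edges -> R -> R) (phi : R).
Hypothesis mX : forall e, measurable_fun setT (X e).
Hypothesis indX : mutually_independent P X.
Hypothesis mf : forall e, measurable_fun setT (f e).
Hypothesis f_ge0 : forall e y, 0 <= f e y.
Hypothesis densX : forall e (A : set R), measurable A ->
  P (X e @^-1` A) = (\int[lebesgue_measure]_(y in A) (f e y)%:E)%E.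
Hypothesis f_le : forall e y, f e y <= phi.

Local Notation others e := (g_sigma_algebraType (other_boxes X e)).

Lemma others_measurable e e' : e' != e ->
  measurable_fun [set: others e] (X e' : others e -> R).
Proof.
move=> ee _ A mA; rewrite setTI; apply: sub_sigma_algebra.
exists (fun i => if i == e' then A else setT) => [i|]; first by case: ifP.
apply/seteqP; split=> w /=; first by move=> Aw i _; case: eqP => [->|].
by move/(_ e' ee); rewrite eqxx.
Qed.

Lemma others_measurableW e (S : Omega -> R) :
  measurable_fun [set: others e] (S : others e -> R) -> measurable_fun setT S.
Proof.
move=> mS _ A mA; have := mS measurableT A mA.
apply: smallest_sub; first exact: sigma_algebra_measurable.
exact: other_boxes_measurable.
Qed.

Lemma others_anti_concentration e (S : Omega -> R) (alpha : R) : 0 <= alpha ->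
  measurable_fun [set: others e] (S : others e -> R) ->
  measurable [set w | (`|X e w - S w| <= alpha)%R] /\
  (P [set w | (`|X e w - S w| <= alpha)%R] <= (2 * alpha * phi)%:E)%E.
Proof.
move=> a0 mS; have mS' := others_measurableW mS; split.
  rewrite -[X in measurable X]setTI; apply: measurable_fun_le => //.
  by apply: measurableT_comp => //; apply: measurable_funB.
apply: (anti_concentration (mX e) mS' _ (mf e)) => // [A B mA mB|]; last exact: densX.
apply: sigma_others_indep => //.
by have := mS measurableT B mB; rewrite setTI.
Qed.

(** The event is a finite union over policies and roots of finite intersections; by
    [linear_on_ball_pos], positivity of a slack on the whole ball is one strict linear inequality at
    the centre. *)
Lemma cell_event_measurable (delta : R) : 0 <= delta ->
  measurable [set w | exists (sigma : max_policy Vmax) (tau : min_policy Vmax),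
     in_Xi E sigma tau /\
     ball_inf (fun e => X e w) delta `<=` Pcell (E:=E) sigma tau].
Proof.
move=> d0.
pose F (p : {ffun 'I_n -> 'I_n} * 'I_n) := [set w | [forall i, E i (p.1 i)] &&
  rooted p.1 p.2 /\ forall q : 'I_n * 'I_n, E q.1 q.2 -> q.2 != p.1 q.1 ->
    forall y, (forall e, `|X e w - y e| <= delta) ->
      0 < policy_gap Vmax (wt y) p.1 p.2 q.1 q.2].
rewrite [X in measurable X](_ : _ = \bigcup_(p in setT) F p).
  apply: fin_bigcup_measurable; first exact: finite_finset.
  move=> p _; rewrite /F.
  have [ok|nok] := boolP ([forall i, E i (p.1 i)] && rooted p.1 p.2); last first.
    by rewrite [X in measurable X](_ : _ = set0) //; apply/seteqP; split=> w [].
  rewrite [X in measurable X](_ : _ = [set w | forall q : 'I_n * 'I_n,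
    E q.1 q.2 && (q.2 != p.1 q.1) -> forall y, (forall e, `|X e w - y e| <= delta) ->
      0 < policy_gap Vmax (wt y) p.1 p.2 q.1 q.2]); last first.
    apply/seteqP; split=> w /=; first by move=> [_ H] q /andP[]; apply: H.
    by move=> H; split=> // q q1 q2; apply: H; rewrite q1.
  apply: forall_measurable => -[i j] /=.
  have [Eij|nE] := boolP (E i j && (j != p.1 i)); last first.
    by rewrite [X in measurable X](_ : _ = setT) //; apply/seteqP; split.
  pose L (r : edges -> R) := policy_gap Vmax (wt r) p.1 p.2 i j.
  have linL : linear_on predT L by apply: policy_gap_linear.
  have [M MP] := linear_on_ball_pos d0 linL.
  rewrite [X in measurable X](_ : _ = setT `&` (fun w => M < L (X ^~ w)) @^-1` [set true]).
    apply: measurable_fun_ltr => //.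
    by apply: (linear_on_measurable linL).
  rewrite setTI; apply/seteqP; split=> w /=; first by move=> H; apply/MP/H.
  by move=> /MP H _; apply: H.
apply/seteqP; split=> w /=.
  move=> [sigma [tau [Xi sub]]].
  move: Xi sub; have := max_part_succ sigma tau; have := min_part_succ sigma tau.
  move: (induced_succ _ _) => g <- <-.
  have <- : [ffun i => g i] = g :> ('I_n -> 'I_n) by apply/funext => i; rewrite ffunE.
  move: [ffun i => g i] => {}g /in_Xi_partsP[Eg [c gc]] sub.
  exists (g, c) => //; split; first by apply/andP; split=> //; apply/forallP.
  move=> [i j] /= Eij ne y xy.
  by have /(Pcell_partsP Vmax _ Eg gc) := sub y xy; apply.
move=> [[g c] _ [/andP[/forallP Eg gc] H]] /=; exists (max_part g), (min_part g).
split; first by apply/in_Xi_partsP; split=> //; exists c.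
move=> y xy; apply/(Pcell_partsP Vmax _ Eg gc) => i j Eij ne.
exact: (H (i, j)).
Qed.

Lemma finite_union_bound (J : finType) (F : J -> set Omega) (b : J -> \bar R) :
  (forall j, measurable (F j)) -> (forall j, P (F j) <= b j)%E ->
  measurable [set w | exists j, F j w] /\
  (P [set w | exists j, F j w] <= \sum_j b j)%E.
Proof.
move=> mF Fb.
have -> : [set w | exists j, F j w] = \big[setU/set0]_j F j.
  apply/seteqP; split=> w /=.
    by move=> [j Fj]; rewrite -bigcup_seq_cond; exists j => //=; rewrite mem_index_enum.
  by rewrite -bigcup_seq_cond => -[j _ Fj]; exists j.
have mU (s : seq J) : measurable (\big[setU/set0]_(j <- s) F j).
  by apply: bigsetU_measurable.
split=> //; elim: (index_enum J) => [|j s IH]; first by rewrite !big_nil measure0.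
rewrite !big_cons; apply: le_trans (measureU2 _ (mF j) (mU s)) _.
exact: leeD (Fb j) IH.
Qed.

Lemma good_cell (delta : R) (r : edges -> R) : 0 < delta ->
  (exists lam u, solves_ergodic Vmax r lam u) -> 'I_n -> generic E (wt r) ->
  (forall e : edges,
    delta *+ (4 * n) < `|r e - threshold Vmax E (val e).1 (val e).2 (wt r)|) ->
  exists (sigma : max_policy Vmax) (tau : min_policy Vmax), in_Xi E sigma tau /\
    ball_inf r delta `<=` Pcell (E:=E) sigma tau.
Proof.
move=> d0 [lam [u /solves_ex_optimal[g o]]] i0 gen far.
have [c gc] := generic_rooted i0 gen o; have [Eg _ _] := o.
exists (max_part g), (min_part g); split.
  by apply/in_Xi_partsP; split=> //; exists c.
move=> r' rr'; apply/(Pcell_partsP Vmax _ Eg gc) => i j Eij ne.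
have := far (exist _ (i, j) Eij); rewrite -wt_val /=.
move=> /(gap_gt_of_threshold gen o Eij ne).
rewrite -(policy_gapE i j gc o) => lt1.
have wd k l : `|wt r k l - wt r' k l| <= delta.
  by rewrite -wtB; apply: wt_bound => //; exact: ltW.
have := policy_gap_bound Vmax i j d0 gc wd.
rewrite policy_gapB card_ord ltr_norml => /andP[_ lt2].
by move: lt1 lt2; lra.
Qed.

End Smoothed.

(** With [a = n] and [k = m] the left side is the total of the union bound, equal to
    [2 / (2 * a + 1)]. *)
Lemma smoothing_radius_bound (R : realFieldType) (a k phi : R) :
  0 < a -> 0 < k -> 0 < phi ->
  2 * ((4 * a * (2 * a + 1) * k * phi)^-1 * (4 * a)) * phi * k <= a^-1.
Proof.
move=> a0 k0 p0.
have b0 : 0 < 2 * a + 1 by lra.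
have -> : 2 * ((4 * a * (2 * a + 1) * k * phi)^-1 * (4 * a)) * phi * k =
    2 / (2 * a + 1).
  by field; rewrite !gt_eqF.
rewrite ler_pdivrMr // mulrDr mulr1 mulrCA mulVf ?gt_eqF //.
by rewrite mulr1 lerDl invr_ge0 ltW.
Qed.

Theorem mainTheorem14 (R : realType) (n : nat) (E : rel 'I_n)
    (Vmax : {set 'I_n})
    (d : measure_display) (Omega : measurableType d)
    (P : probability Omega R)
    (r : edge n E -> Omega -> R) (f : edge n E -> R -> R) (phi : R) :
  (0 < n)%N ->
  (forall i : 'I_n, exists j, E i j) ->
  ergodic_graph (R:=R) E Vmax ->
  (forall e, measurable_fun setT (r e)) ->
  mutually_independent P r ->
  (forall e, measurable_fun setT (f e)) ->
  (forall e y, 0 <= f e y) ->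
  (forall e (A : set R), measurable A ->
     P (r e @^-1` A) = (\int[lebesgue_measure]_(y in A) (f e y)%:E)%E) ->
  0 < phi ->
  (forall e y, f e y <= phi) ->
  let m := #|{: edge n E}| in
  let delta := ((4 * n * (2 * n + 1) * m)%:R * phi)^-1 in
  ((1 - n%:R^-1)%:E <=
   P [set w | exists (sigma : max_policy Vmax) (tau : min_policy Vmax),
        in_Xi E sigma tau /\
        ball_inf (fun e => r e w) delta `<=` Pcell (E:=E) sigma tau])%E.
Proof.
move=> n0 outE erg mX indX mf f0 dens phi0 fphi; cbv zeta.
set m := #|_|; set delta := (_ * phi)^-1.
have i0 : 'I_n := Ordinal n0.
have m0 : (0 < m)%N.
  have [j Ej] := outE i0; apply/card_gt0P.
  by exists (exist _ (i0, j) Ej).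
have delta0 : 0 < delta.
  by rewrite invr_gt0 mulr_gt0 // ltr0n !muln_gt0 n0 m0 addn1.
pose alpha := delta *+ (4 * n).
have alpha0 : 0 <= alpha by rewrite mulrn_wge0 // ltW.
pose T (e : edge n E) w := threshold Vmax E (val e).1 (val e).2 (wt (r ^~ w)).
have badE e : measurable [set w | (`|r e w - T e w| <= alpha)%R] /\
    (P [set w | (`|r e w - T e w| <= alpha)%R] <= (2 * alpha * phi)%:E)%E.
  apply: (others_anti_concentration mX indX mf f0 dens fphi) => //.
  apply: threshold_measurable => e' ee'; apply: others_measurable.
  by apply: contra ee' => /eqP ->; rewrite -surjective_pairing.
(* A tie puts one weight on a functional of the others, a null event by anti-concentration with
   radius 0. When [q] is not a cycle pair, the empty set serves. *)
have tieE q : exists F : set Omega, [/\ measurable F, (P F <= 0)%E &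
    forall w, cycle_pair E q -> cycle_tie q (r ^~ w) -> F w].
  have [cq|nq] := boolP (cycle_pair E q); last first.
    by exists set0; split=> [||w cq]; rewrite ?measure0 ?cq // in nq *.
  have [e [L [linL eL]]] := @cycle_tie_hyperplane R _ _ _ cq.
  have := others_anti_concentration (e := e) (S := fun w => L (r ^~ w))
    mX indX mf f0 dens fphi (lexx 0).
  case.
    by apply: (linear_on_measurable linL) => e'; apply: others_measurable.
  move=> mF PF; exists [set w | (`|r e w - L (r ^~ w)| <= 0)%R]; split=> //.
    by apply: le_trans PF _; rewrite mulr0 mul0r.
  by move=> w _ /eL /= ->; rewrite subrr normr0.
have [F FP] := choice tieE.
(* The bad events: one null event per possible tie, and one per edge for a weight too close to its
   threshold. *)
pose tieT := ({ffun 'I_n -> 'I_n} * {set 'I_n} * {set 'I_n})%type.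
pose B (j : (tieT + edge n E)%type) : set Omega :=
  match j with
  | inl q => F q | inr e => [set w | (`|r e w - T e w| <= alpha)%R]
  end.
pose b (j : (tieT + edge n E)%type) : \bar R :=
  match j with inl q => 0%E | inr e => (2 * alpha * phi)%:E end.
have [mB PB] : measurable [set w | exists j, B j w] /\
    (P [set w | exists j, B j w] <= \sum_j b j)%E.
  by apply: finite_union_bound => -[q|e] /=; [case: (FP q)|case: (badE e)
    |case: (FP q)|case: (badE e)].
set W := [set w | exists sigma tau, _].
have mW : measurable W by exact: (cell_event_measurable Vmax mX (ltW delta0)).
have BW : ~` [set w | exists j, B j w] `<=` W.
  move=> w nB; apply: (good_cell delta0) => //.
  - apply: generic_of_no_tie => q cq tq; apply: nB; exists (inl q).
    by case: (FP q) => _ _; apply.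
  - by move=> e; rewrite ltNge; apply/negP => le; apply: nB; exists (inr e).
apply: (@le_trans _ _ (P (~` [set w | exists j, B j w]))); last first.
  by apply: le_measure; rewrite ?inE //; exact: measurableC.
rewrite probability_setC // EFinB leeB //.
apply: le_trans PB _.
(* Only the [m] edges contribute to the sum. *)
rewrite big_sumType /= big1 // add0e sumEFin lee_fin sumr_const -/m.
rewrite /alpha /delta; clearbody m.
rewrite -[_ *+ m]mulr_natr -[_ *+ (4 * n)]mulr_natr !natrM natrD natrM.
by apply: smoothing_radius_bound; rewrite ?ltr0n.
Qed.
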